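(* Assume $\rho(\bar{\mathcal A}^{\rm QVI})<\rho(\mathcal A^{\rm QVI})$. Then there exists $\eta_0>0$ such that every $\eta$ with $$0<\eta<\min\left\{\rho(\mathcal A^{\rm QVI})^2,\ \eta_0\right\}$$ satisfies $$\rho(\mathcal A^{\rm HB})<\rho(\mathcal A^{\rm QVI}).$$ Consequently, for every such $\eta$, the error of the heavy-ball recursion $Q_{k+1}=Q_k+\alpha(F(Q_k)-Q_k)+\eta(Q_k-Q_{k-1})$ converges exponentially to zero, i.e. there exist constants $C\ge 1$ and $\beta\in(0,1)$ such that for all initial $Q_0,Q_{-1}\in\mathbb R^n$ and all $k\ge 0$, $$\left\|\begin{bmatrix}Q_k-Q^\star\\Q_{k-1}-Q^\star\end{bmatrix}\right\|_2\le C\beta^k\left\|\begin{bmatrix}Q_0-Q^\star\\Q_{-1}-Q^\star\end{bmatrix}\right\|_2,$$ the worst-case joint spectral radius $\rho(\mathcal A^{\rm HB})$ governing this recursion being strictly smaller than the one, $\rho(\mathcal A^{\rm QVI})$, of standard Q-value iteration.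
   Context: Finite discounted MDP: state set $\mathcal S=\{1,\dots,|\mathcal S|\}$, action set $\mathcal A=\{1,\dots,|\mathcal A|\}$, transition probabilities $P(s'\mid s,a)$, real rewards $r(s,a,s')$, expected reward $R(s,a)=\sum_{s'}P(s'\mid s,a)r(s,a,s')$, discount factor $\gamma\in(0,1)$. Put $n=|\mathcal S||\mathcal A|$. Functions on state-action pairs are vectors in $\mathbb R^n$ (ordering $(1,1),(2,1),\dots,(|\mathcal S|,1),(1,2),\dots$). $P\in\mathbb R^{n\times|\mathcal S|}$ is the matrix with $((s,a),s')$ entry $P(s'\mid s,a)$, and $R\in\mathbb R^n$ is the vector of expected rewards. A stochastic policy $\mu$ assigns to each state $s$ a probability vector $\mu(\cdot\mid s)$ on $\mathcal A$; $\Pi^\mu\in\mathbb R^{|\mathcal S|\times n}$ is the matrix with $(\Pi^\mu Q)(s)=\sum_a\mu(a\mid s)Q(s,a)$. $\Theta$ is the (finite) set of deterministic policies $\pi:\mathcal S\to\mathcal A$, viewed as stochastic policies by one-hot encoding. $V_Q(s)=\max_aQ(s,a)$, $F(Q)=R+\gamma PV_Q$ is the Bellman optimality operator, and $Q^\star$ is its unique fixed point. The step-size satisfies $0<\alpha\le1$. Standard QVI is $Q_{k+1}=Q_k+\alpha(F(Q_k)-Q_k)$. For a policy $\pi$, $$A_\pi^{\rm QVI}=(1-\alpha)I+\alpha\gamma P\Pi^\pi,\qquad A_\pi^{\rm HB}=\begin{bmatrix}(1-\alpha+\eta)I+\alpha\gamma P\Pi^\pi&-\eta I\\ I&0\end{bmatrix},$$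 $\mathcal A^{\rm QVI}=\{A_\pi^{\rm QVI}:\pi\in\Theta\}$, $\mathcal A^{\rm HB}=\{A_\pi^{\rm HB}:\pi\in\Theta\}$ (depending on $\eta$). Let $U\in\mathbb R^{n\times(n-1)}$ have orthonormal columns spanning $\operatorname{span}\{\mathbf 1\}^\perp$, where $\mathbf 1$ is the all-ones vector; $\bar A_\pi^{\rm QVI}=U^\top A_\pi^{\rm QVI}U$ and $\bar{\mathcal A}^{\rm QVI}=\{\bar A_\pi^{\rm QVI}:\pi\in\Theta\}$. For a bounded set $\mathcal H$ of square matrices, $\rho(\mathcal H)=\lim_{k\to\infty}\sup_{A_1,\dots,A_k\in\mathcal H}\|A_k\cdots A_1\|^{1/k}$ is the joint spectral radius (independent of the submultiplicative norm). *)

(* Defs.v *)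
From HB Require Import structures.
From mathcomp Require Import all_boot all_order all_algebra.
From mathcomp Require Import all_classical all_reals all_analysis.

Set Implicit Arguments.
Unset Strict Implicit.
Unset Printing Implicit Defensive.

Import Order.TTheory GRing.Theory Num.Theory.
Import numFieldNormedType.Exports.

Local Open Scope classical_set_scope.
Local Open Scope ring_scope.

(* Frobenius norm: submultiplicative on square matrices, and equal to the
   Euclidean norm on column vectors. *)
Definition norm2 (R : realType) (m n : nat) (A : 'M[R]_(m, n)) : R :=
  Num.sqrt (\sum_i \sum_j A i j ^+ 2).

(* For s = [:: A_1; ..; A_k] the fold is A_k *m .. *m A_1.  The value of the
   sequence at k = 0 is irrelevant to the limit; the limit exists whenever H is
   nonempty and bounded. *)
Definition jsr (R : realType) (m : nat) (H : set 'M[R]_m) : R :=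
  lim ((fun k : nat =>
    sup [set norm2 (foldl (fun B A => A *m B) 1%:M s) `^ (k%:R)^-1
        | s in [set s : k.-tuple 'M[R]_m | forall i, H (tnth s i)]]) @ \oo).

(* State and action sets are nonempty: they have nS.+1 and nA.+1 elements. *)
Record mdp (R : realType) (nS nA : nat) := Mdp {
  trans : 'I_nS.+1 -> 'I_nA.+1 -> 'I_nS.+1 -> R; (* trans s a s' = P(s' | s, a) *)
  reward : 'I_nS.+1 -> 'I_nA.+1 -> 'I_nS.+1 -> R;
  discount : R;
  trans_ge0 : forall s a s', 0 <= trans s a s';
  trans_sum1 : forall s a, \sum_s' trans s a s' = 1;
  discount_gt0 : 0 < discount;
  discount_lt1 : discount < 1
}.

Definition sa_dim (nS nA : nat) : nat := (nA.+1 * nS.+1)%N.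

(* mxvec is row-major, so with actions as rows the entries are ordered
   (1,1), (2,1), .., (|S|,1), (1,2), .. *)
Definition sa_vec (R : realType) (nS nA : nat) (f : 'I_nS.+1 -> 'I_nA.+1 -> R) :
  'cV[R]_(sa_dim nS nA) := (mxvec (\matrix_(a, s) f s a))^T.

Definition sa_val (R : realType) (nS nA : nat) (Q : 'cV[R]_(sa_dim nS nA))
  (s : 'I_nS.+1) (a : 'I_nA.+1) : R := Q (mxvec_index a s) 0.

Lemma sa_vecK (R : realType) (nS nA : nat) (f : 'I_nS.+1 -> 'I_nA.+1 -> R) s a :
  sa_val (sa_vec f) s a = f s a.
Proof. by rewrite /sa_val /sa_vec mxE mxvecE mxE. Qed.

(* Pi^mu, for mu s a = mu(a | s). *)
Definition policy_mx (R : realType) (nS nA : nat)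
  (mu : 'I_nS.+1 -> 'I_nA.+1 -> R) : 'M[R]_(nS.+1, sa_dim nS nA) :=
  \matrix_(s, i) sa_vec (fun s' a => if s' == s then mu s a else 0) i 0.

Lemma policy_mxE (R : realType) (nS nA : nat) (mu : 'I_nS.+1 -> 'I_nA.+1 -> R)
    (Q : 'cV[R]_(sa_dim nS nA)) s :
  (policy_mx mu *m Q) s 0 = \sum_a mu s a * sa_val Q s a.
Proof.
rewrite mxE (reindex _ (curry_mxvec_bij _ _)) /=.
transitivity (\sum_a \sum_s' policy_mx mu s (mxvec_index a s') * sa_val Q s' a).
  by rewrite pair_bigA /=; apply: eq_bigr => -[a s'] _.
apply: eq_bigr => a _; rewrite (bigD1 s) //= big1 ?addr0 => [|s' s's].
  by rewrite mxE -/(sa_val _ _ _) sa_vecK eqxx.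
by rewrite mxE -/(sa_val (sa_vec _) _ _) sa_vecK (negPf s's) mul0r.
Qed.

Definition one_hot (R : realType) (nS nA : nat)
  (pi : {ffun 'I_nS.+1 -> 'I_nA.+1}) (s : 'I_nS.+1) (a : 'I_nA.+1) : R :=
  (a == pi s)%:R.

Section MDP.
Variables (R : realType) (nS nA : nat) (M : mdp R nS nA).
Local Notation n := (sa_dim nS nA).
Local Notation gamma := (discount M).

Definition trans_mx : 'M[R]_(n, nS.+1) :=
  \matrix_(i, s') sa_vec (fun s a => trans M s a s') i 0.

Definition reward_vec : 'cV[R]_n :=
  sa_vec (fun s a => \sum_s' trans M s a s' * reward M s a s').

Definition greedy_value (Q : 'cV[R]_n) : 'cV[R]_nS.+1 :=
  \col_s \big[Num.max/sa_val Q s ord0]_a sa_val Q s a.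

Definition bellman (Q : 'cV[R]_n) : 'cV[R]_n :=
  reward_vec + gamma *: (trans_mx *m greedy_value Q).

Definition qvi_mx (alpha : R) (pi : {ffun 'I_nS.+1 -> 'I_nA.+1}) : 'M[R]_n :=
  (1 - alpha)%:M + (alpha * gamma) *: (trans_mx *m policy_mx (one_hot R pi)).

Definition hb_mx (alpha eta : R) (pi : {ffun 'I_nS.+1 -> 'I_nA.+1}) :
  'M[R]_(n + n) :=
  block_mx ((1 - alpha + eta)%:M
              + (alpha * gamma) *: (trans_mx *m policy_mx (one_hot R pi)))
           (- eta%:M)
           1%:M 0.

Definition qvi_family (alpha : R) : set 'M[R]_n := range (qvi_mx alpha).

Definition hb_family (alpha eta : R) : set 'M[R]_(n + n) :=
  range (hb_mx alpha eta).

Definition qvi_proj_family (U : 'M[R]_(n, n.-1)) (alpha : R) :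
  set 'M[R]_n.-1 := range (fun pi => U^T *m qvi_mx alpha pi *m U).

(* The columns of U are orthonormal and span the orthogonal complement of the
   all-ones vector. *)
Definition ones_complement_basis (U : 'M[R]_(n, n.-1)) : Prop :=
  U^T *m U = 1%:M /\
  forall x : 'cV[R]_n,
    (exists y : 'cV[R]_n.-1, x = U *m y) <-> (const_mx 1 : 'rV[R]_n) *m x = 0.

Definition hb_step (alpha eta : R) (z : 'cV[R]_n * 'cV[R]_n) :
  'cV[R]_n * 'cV[R]_n :=
  (z.1 + alpha *: (bellman z.1 - z.1) + eta *: (z.1 - z.2), z.1).

(* The pair (Q_k, Q_(k-1)) of the recursion started from Q_0 and Q_(-1). *)
Definition hb_iter (alpha eta : R) (Q0 Qm1 : 'cV[R]_n) (k : nat) :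
  'cV[R]_n * 'cV[R]_n := iter k (hb_step alpha eta) (Q0, Qm1).

End MDP.

(* Main.v *)
Require Import Defs.
From HB Require Import structures.
From mathcomp Require Import all_boot all_order all_algebra.
From mathcomp Require Import all_classical all_reals all_analysis.
From mathcomp Require Import ring lra.

(** Every matrix A of the value-iteration family is nonnegative with all row
    sums equal to r = 1 - alpha + alpha gamma.  Products of k factors have row
    sums r ^ k, so the joint spectral radius of the family is r
    ([jsr_constant_row_sum]), and the all-ones vector 1 is a common eigenvector.
    Split a vector as x = U y + c 1.  The gap hypothesis says that the
    transverse parts U^T A U contract strictly faster than r.  Turning this into
    a usable estimate takes two steps: Fekete's argument
    ([cvg_root_submultiplicative]) shows that the limit defining the joint
    spectral radius exists, so products of length k are bounded by C q ^ k with
    q < r ([jsr_lt_growth]); and the supremum of |A_w y| / q ^ |w| over all words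
    w is then a norm in which every U^T A U contracts by q ([contracting_norm]).

    Adding the momentum term decouples in the same way up to a triangular
    coupling.  In the transverse part the momentum is a perturbation of size
    eta, and a rate q' strictly between q and r survives for small eta.  On the
    line spanned by 1 the pair (c_k, c_(k-1)) follows a two-term recursion with
    characteristic polynomial X^2 - (r + eta) X + eta.  Its value at r is
    eta (1 - r) > 0, so for small eta it has two real roots, both in ]0, r[
    ([heavy_ball_roots]): momentum strictly accelerates the dominant mode.  A
    weighted maximum of the transverse norm and of the two eigen-coordinates of
    the recursion is contracted by some b < r ([heavy_ball_norm]), where a large
    weight on the transverse part absorbs the coupling.  This bounds the joint
    spectral radius of the heavy-ball family by b.

    The error of the recursion is governed by greedy maxima rather than by one
    policy.  A difference of two maxima is an average of the coordinatewise
    differences ([max_difference_convex]), so the error evolves by the heavy-ball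
    matrix of some stochastic policy at each step ([hb_step_error]).  Such a
    policy is a convex combination of deterministic ones
    ([policy_weight_marginal]) and norms are convex, so the same norm contracts
    by b < r < 1 along the recursion. *)

Set Implicit Arguments.
Unset Strict Implicit.
Unset Printing Implicit Defensive.

Import Order.TTheory GRing.Theory Num.Theory.
Import numFieldNormedType.Exports.

Local Open Scope classical_set_scope.
Local Open Scope ring_scope.

(** * Frobenius norm *)

(** Lagrange's identity: the defect is half the sum of the squares of all
    2 x 2 minors of the pair (a, b). *)
Lemma cauchy_schwarz_sum (R : realType) (I : finType) (a b : I -> R) :
  (\sum_i a i * b i) ^+ 2 <= (\sum_i a i ^+ 2) * (\sum_i b i ^+ 2).
Proof.
have : 0 <= \sum_i \sum_j (a i * b j - a j * b i) ^+ 2.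
  by apply: sumr_ge0 => i _; apply: sumr_ge0 => j _; exact: sqr_ge0.
have -> : \sum_i \sum_j (a i * b j - a j * b i) ^+ 2 =
    \sum_i \sum_j (a i ^+ 2 * b j ^+ 2) + \sum_i \sum_j (b i ^+ 2 * a j ^+ 2)
    - 2 * \sum_i \sum_j ((a i * b i) * (a j * b j)).
  rewrite mulr_sumr -big_split -sumrB; apply: eq_bigr => i _ /=.
  rewrite mulr_sumr -big_split -sumrB; apply: eq_bigr => j _ /=.
  by ring.
rewrite -!big_distrlr /=; set A := \sum_i a i ^+ 2; set B := \sum_i b i ^+ 2.
by set S := \sum_i _; lra.
Qed.

Lemma norm2_ge0 (R : realType) (m n : nat) (A : 'M[R]_(m, n)) : 0 <= norm2 A.
Proof. exact: sqrtr_ge0. Qed.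

Lemma norm2_sqr (R : realType) (m n : nat) (A : 'M[R]_(m, n)) :
  norm2 A ^+ 2 = \sum_i \sum_j A i j ^+ 2.
Proof.
by rewrite sqr_sqrtr //; apply: sumr_ge0 => i _; apply: sumr_ge0 => j _;
  exact: sqr_ge0.
Qed.

Lemma norm2_entry (R : realType) (m n : nat) (A : 'M[R]_(m, n)) i j :
  `|A i j| <= norm2 A.
Proof.
rewrite -(@ler_pXn2r _ 2) ?nnegrE ?norm2_ge0 // norm2_sqr real_normK ?num_real //.
rewrite (bigD1 i) //= (bigD1 j) //= -addrA lerDl addr_ge0 ?sumr_ge0 // => k _;
  rewrite ?sqr_ge0 //.
by apply: sumr_ge0 => l _; exact: sqr_ge0.
Qed.

Lemma norm2M (R : realType) (m n p : nat) (A : 'M[R]_(m, n)) (B : 'M[R]_(n, p)) :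
  norm2 (A *m B) <= norm2 A * norm2 B.
Proof.
rewrite -(@ler_pXn2r _ 2) ?nnegrE ?mulr_ge0 ?norm2_ge0 // exprMn !norm2_sqr.
rewrite [X in _ <= _ * X]exchange_big /= big_distrlr /=.
apply: ler_sum => i _; apply: ler_sum => j _; rewrite mxE.
exact: cauchy_schwarz_sum.
Qed.

Lemma norm2D (R : realType) (m n : nat) (A B : 'M[R]_(m, n)) :
  norm2 (A + B) <= norm2 A + norm2 B.
Proof.
have CS : \sum_i \sum_j A i j * B i j <= norm2 A * norm2 B.
  apply: (le_trans (ler_norm _)).
  rewrite -(@ler_pXn2r _ 2) ?nnegrE ?mulr_ge0 ?norm2_ge0 // exprMn !norm2_sqr.
  rewrite real_normK ?num_real // !pair_bigA /=.
  exact: cauchy_schwarz_sum.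
rewrite -(@ler_pXn2r _ 2) ?nnegrE ?addr_ge0 ?norm2_ge0 // sqrrD !norm2_sqr.
have -> : \sum_i \sum_j (A + B) i j ^+ 2 = \sum_i \sum_j A i j ^+ 2
    + (\sum_i \sum_j A i j * B i j) *+ 2 + \sum_i \sum_j B i j ^+ 2.
  rewrite -sumrMnl -!big_split; apply: eq_bigr => i _ /=.
  rewrite -sumrMnl -!big_split; apply: eq_bigr => j _ /=.
  by rewrite mxE sqrrD.
by rewrite lerD2r lerD2l lerMn2r CS orbT.
Qed.

Lemma norm2Z (R : realType) (m n : nat) (c : R) (A : 'M[R]_(m, n)) :
  norm2 (c *: A) = `|c| * norm2 A.
Proof.
apply/eqP; rewrite -(@eqrXn2 _ 2) ?mulr_ge0 ?norm2_ge0 //.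
rewrite exprMn !norm2_sqr real_normK ?num_real // mulr_sumr.
apply/eqP/eq_bigr => i _; rewrite mulr_sumr; apply: eq_bigr => j _.
by rewrite mxE exprMn.
Qed.

Lemma norm2_0 (R : realType) (m n : nat) : norm2 (0 : 'M[R]_(m, n)) = 0.
Proof. by rewrite -[0](scale0r (0 : 'M[R]_(m, n))) norm2Z normr0 mul0r. Qed.

Lemma norm2_sum (R : realType) (m n : nat) (I : finType) (F : I -> 'M[R]_(m, n)) :
  norm2 (\sum_i F i) <= \sum_i norm2 (F i).
Proof.
elim/big_ind2: _ => [|x1 x2 y1 y2 h1 h2|//]; first by rewrite norm2_0.
exact: (le_trans (norm2D _ _) (lerD h1 h2)).
Qed.

Lemma norm2_delta (R : realType) (m n : nat) (i : 'I_m) (j : 'I_n) :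
  norm2 (delta_mx i j : 'M[R]_(m, n)) = 1.
Proof.
rewrite /norm2 (bigD1 i) //= (bigD1 j) //= !big1 ?mxE ?eqxx ?addr0 ?expr1n ?sqrtr1 //.
  by move=> k ki; apply: big1 => l _; rewrite mxE (negPf ki) expr0n.
by move=> k kj; rewrite mxE (negPf kj) andbF expr0n.
Qed.

Lemma norm2_le_sum (R : realType) (m n : nat) (A : 'M[R]_(m, n)) :
  norm2 A <= \sum_i \sum_j `|A i j|.
Proof.
rewrite {1}(matrix_sum_delta A); apply: (le_trans (norm2_sum _)).
apply: ler_sum => i _; apply: (le_trans (norm2_sum _)).
by apply: ler_sum => j _; rewrite norm2Z norm2_delta mulr1.
Qed.

Lemma norm2_le_entries (R : realType) (m n : nat) (A : 'M[R]_(m, n)) (c : R) :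
  (forall i j, `|A i j| <= c) -> norm2 A <= (m * n)%:R * c.
Proof.
move=> hA; apply: (le_trans (norm2_le_sum A)).
apply: (@le_trans _ _ (\sum_(i < m) \sum_(j < n) c)).
  by apply: ler_sum => i _; apply: ler_sum => j _.
by rewrite !sumr_const !card_ord -mulrnA mulnC mulr_natl.
Qed.

Lemma norm2_le_operator (R : realType) (m n : nat) (A : 'M[R]_(m, n)) (c : R) :
  (forall x : 'cV[R]_n, norm2 (A *m x) <= c * norm2 x) ->
  norm2 A <= (m * n)%:R * c.
Proof.
move=> hA; apply: norm2_le_entries => i j.
have := hA (delta_mx j 0); rewrite norm2_delta mulr1.
have -> : A i j = col j A i 0 by rewrite mxE.
by apply: le_trans; rewrite -colE norm2_entry.
Qed.

Lemma norm2_col_mx (R : realType) (m n : nat) (x : 'cV[R]_m) (y : 'cV[R]_n) :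
  norm2 (col_mx x y) ^+ 2 = norm2 x ^+ 2 + norm2 y ^+ 2.
Proof.
rewrite !norm2_sqr big_split_ord /=; congr (_ + _); apply: eq_bigr => i _;
  by apply: eq_bigr => j _; rewrite ?col_mxEu ?col_mxEd.
Qed.

Lemma norm2_le_col_mx (R : realType) (m n : nat) (x : 'cV[R]_m) (y : 'cV[R]_n) :
  norm2 x <= norm2 (col_mx x y) /\ norm2 y <= norm2 (col_mx x y).
Proof.
rewrite -!(@ler_pXn2r _ 2 _ _ (norm2 (col_mx x y))) ?nnegrE ?norm2_ge0 //.
by rewrite norm2_col_mx lerDl lerDr !sqr_ge0.
Qed.

Lemma norm2_col_mx_le (R : realType) (m n : nat) (x : 'cV[R]_m) (y : 'cV[R]_n) :
  norm2 (col_mx x y) <= norm2 x + norm2 y.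
Proof.
rewrite -(@ler_pXn2r _ 2) ?nnegrE ?addr_ge0 ?norm2_ge0 // norm2_col_mx.
by rewrite sqrrD lerD2r lerDl mulrn_wge0 // mulr_ge0 ?norm2_ge0.
Qed.

(** * Growth rates of submultiplicative sequences *)

Lemma cvg_root1 (R : realType) (c : R) : 0 < c ->
  (fun k : nat => c `^ k%:R^-1) @ \oo --> (1 : R).
Proof.
move=> c0; rewrite -cvg_shiftS.
have -> : (fun k : nat => c `^ k.+1%:R^-1) =
    expR \o (fun k => @harmonic R k * ln c).
  by apply/funext => k /=; rewrite /powR gt_eqF.
rewrite -[1]expR0; apply: continuous_cvg; first exact: continuous_expR.
by rewrite -[0](mul0r (ln c)); apply: cvgMl; exact: cvg_harmonic.
Qed.

Lemma root_geometric (R : realType) (c q : R) (k : nat) : 0 <= c -> 0 <= q ->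
  (0 < k)%N -> (c * q ^+ k) `^ k%:R^-1 = c `^ k%:R^-1 * q.
Proof.
move=> c0 q0 k0; rewrite powRM ?exprn_ge0 // -powR_mulrn // -powRrM.
by rewrite divff ?pnatr_eq0 -?lt0n // powRr1.
Qed.

Lemma cvg_root_geometric (R : realType) (c q : R) : 0 < c -> 0 <= q ->
  (fun k : nat => (c * q ^+ k) `^ k%:R^-1) @ \oo --> q.
Proof.
move=> c0 q0; have h : (fun k : nat => c `^ k%:R^-1 * q) @ \oo --> q.
  by rewrite -[X in _ --> X]mul1r; apply: cvgMl; exact: cvg_root1.
apply: cvg_trans h; apply: near_eq_cvg; near=> k.
by rewrite root_geometric ?(ltW c0) //; near: k; exact: nbhs_infty_gt.
Unshelve. all: by end_near. Qed.

(** Cutting k into blocks of length m, one good value [u m <= t ^+ m] controls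
    all later ones; the constant pays for the incomplete last block. *)
Lemma submultiplicative_growth (R : realType) (u : nat -> R) (m : nat) (t : R) :
  (forall k, 0 <= u k) -> (forall k l, u (k + l)%N <= u k * u l) ->
  (0 < m)%N -> 0 < t -> u m <= t ^+ m ->
  exists2 C : R, 0 < C & forall k, u k <= C * t ^+ k.
Proof.
move=> u0 uM m0 t0 um.
(* The summand 1 only serves to make the constant positive. *)
exists (1 + \sum_(j < m) u j / t ^+ j).
  by rewrite ltr_wpDr // sumr_ge0 // => j _; rewrite divr_ge0 ?exprn_ge0 ?(ltW t0).
move=> k; rewrite {1}(divn_eq k m).
apply: (@le_trans _ _ (u m ^+ (k %/ m) * u (k %% m)%N)).
  elim: (k %/ m)%N => [|a IH]; first by rewrite mul0n add0n expr0 mul1r.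
  rewrite mulSn -addnA exprS -mulrA; apply: (le_trans (uM _ _)).
  by rewrite ler_wpM2l.
have -> : t ^+ k = t ^+ (m * (k %/ m)) * t ^+ (k %% m).
  by rewrite -exprD mulnC -divn_eq.
rewrite mulrCA exprM; apply: ler_pM => //; first exact: exprn_ge0.
  by rewrite lerXn2r ?nnegrE ?exprn_ge0 ?(ltW t0).
rewrite -ler_pdivrMr ?exprn_gt0 //.
rewrite (bigD1 (Ordinal (ltn_pmod k m0))) //= addrCA lerDl addr_ge0 ?sumr_ge0 //.
by move=> j _; rewrite divr_ge0 ?exprn_ge0 ?(ltW t0).
Qed.

(** Fekete's lemma in multiplicative form: the limit is the infimum over
    k > 0.  Arguing with upper bounds only, instead of taking logarithms, also
    covers sequences that vanish. *)
Lemma cvg_root_submultiplicative (R : realType) (u : nat -> R) :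
  (forall k, 0 <= u k) -> (forall k l, u (k + l)%N <= u k * u l) ->
  cvg ((fun k => u k `^ k%:R^-1) @ \oo).
Proof.
move=> u0 uM; set v := fun k => _.
pose S := [set v k | k in [set k | (0 < k)%N]]; pose L := inf S.
have S0 : S !=set0 by exists (v 1%N); exists 1%N.
have Slb : has_lbound S by exists 0 => _ [k _ <-]; exact: powR_ge0.
have vL k : (0 < k)%N -> L <= v k by move=> k0; apply: ge_inf => //; exists k.
have L0 : 0 <= L by apply: lb_le_inf => // _ [k _ <-]; exact: powR_ge0.
apply/cvg_ex; exists L; apply/cvgrPdist_lt => e e0.
have [_ [m m0 <-] vm] : exists2 x, S x & x < L + e / 2.
  by apply: inf_adherent; [rewrite divr_gt0|].
set t := L + e / 2 in vm; have t0 : 0 < t by rewrite ltr_wpDl ?divr_gt0.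
have um : u m <= t ^+ m.
  have -> : u m = v m ^+ m.
    by rewrite -powR_mulrn ?powR_ge0 // -powRrM mulVf ?pnatr_eq0 -?lt0n // powRr1.
  by rewrite lerXn2r ?nnegrE ?powR_ge0 ?ltW.
have [C C0 uC] := submultiplicative_growth u0 uM m0 t0 um.
have tL : t < L + e by rewrite ltrD2l gtr_pMr // invf_lt1 ?ltr1n.
have geo : \forall k \near \oo, (C * t ^+ k) `^ k%:R^-1 < L + e.
  by apply: cvgr_lt tL; exact: cvg_root_geometric C0 (ltW t0).
near=> k; have k0 : (0 < k)%N by near: k; exact: nbhs_infty_gt.
rewrite ler0_norm ?subr_le0 ?vL // opprB ltrBlDl.
apply: (@le_lt_trans _ _ ((C * t ^+ k) `^ k%:R^-1)); last by near: k.
by rewrite ge0_ler_powR ?invr_ge0 ?nnegrE ?mulr_ge0 ?exprn_ge0 ?(ltW C0) ?(ltW t0).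
Unshelve. all: by end_near. Qed.

(** * Joint spectral radius of a finite family *)

Section FiniteFamily.
Variables (R : realType) (m : nat) (T : finType) (f : T -> 'M[R]_m).

(** The letter read first acts first, as in the folds defining [jsr]. *)
Definition word_mx (w : seq T) : 'M[R]_m :=
  foldl (fun B t => f t *m B) 1%:M w.

Lemma word_mx_foldl (w : seq T) (B : 'M[R]_m) :
  foldl (fun B t => f t *m B) B w = word_mx w *m B.
Proof.
rewrite /word_mx -[in LHS](mul1mx B); elim: w 1%:M => [//|t w IH] C /=.
by rewrite mulmxA IH.
Qed.

Lemma word_mx_cons (t : T) (w : seq T) : word_mx (t :: w) = word_mx w *m f t.
Proof. by rewrite /word_mx /= mulmx1 word_mx_foldl. Qed.

Lemma word_mx_rcons (w : seq T) (t : T) : word_mx (rcons w t) = f t *m word_mx w.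
Proof. by rewrite /word_mx -cats1 foldl_cat. Qed.

Lemma word_mx_cat (w1 w2 : seq T) :
  word_mx (w1 ++ w2) = word_mx w2 *m word_mx w1.
Proof. by rewrite {1}/word_mx foldl_cat word_mx_foldl. Qed.

Definition max_growth (k : nat) : R :=
  \big[Num.max/0]_(w : k.-tuple T) norm2 (word_mx w).

Lemma max_growth_ge0 (k : nat) : 0 <= max_growth k.
Proof. exact: bigmax_ge_id. Qed.

Lemma le_max_growth (w : seq T) : norm2 (word_mx w) <= max_growth (size w).
Proof. exact: (le_bigmax _ (fun v : _.-tuple T => norm2 (word_mx v)) (in_tuple w)). Qed.

Lemma max_growth_le (k : nat) (c : R) : 0 <= c ->
  (forall w, size w = k -> norm2 (word_mx w) <= c) -> max_growth k <= c.
Proof. by move=> c0 h; apply: bigmax_le => // w _; rewrite h ?size_tuple. Qed.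

Lemma max_growthM (k l : nat) : max_growth (k + l) <= max_growth k * max_growth l.
Proof.
apply: max_growth_le => [|w sw]; first by rewrite mulr_ge0 ?max_growth_ge0.
rewrite -(cat_take_drop k w) word_mx_cat [leRHS]mulrC; apply: (le_trans (norm2M _ _)).
have sk : size (take k w) = k by rewrite size_takel // sw leq_addr.
have sl : size (drop k w) = l by rewrite size_drop sw addKn.
have := le_max_growth (take k w); rewrite sk => hk.
have := le_max_growth (drop k w); rewrite sl => hl.
by rewrite ler_pM ?norm2_ge0.
Qed.

Hypothesis T0 : (0 < #|T|)%N.

(** For a finite family the supremum over products is attained, so it
    commutes with the k-th root. *)
Lemma jsrE : jsr (range f) = lim ((fun k => max_growth k `^ k%:R^-1) @ \oo).
Proof.
rewrite /jsr; congr (lim (_ @ \oo)); apply/funext => k.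
have foldE (w : seq T) :
    foldl (fun B A => A *m B) 1%:M (map f w) = word_mx w.
  rewrite /word_mx; elim: w 1%:M => [//|t w IH] B /=; exact: IH.
set S := (X in sup X).
have Sub : ubound S (max_growth k `^ k%:R^-1).
  move=> _ [s /= hs <-].
  have [g hg] : {g : 'I_k -> T & forall i, f (g i) = tnth s i}.
    apply: (choice (P := fun i t => f t = tnth s i)) => i.
    by have [t _ <-] := hs i; exists t.
  have -> : tval s = map f [seq g i | i <- enum 'I_k].
    rewrite -map_comp (eq_map (g := tnth s)); last by move=> i /=; exact: hg.
    by rewrite map_tnth_enum.
  rewrite foldE ge0_ler_powR ?invr_ge0 ?nnegrE ?norm2_ge0 ?max_growth_ge0 //.
  rewrite -[k in max_growth k](_ : size [seq g i | i <- enum 'I_k] = k).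
    exact: le_max_growth.
  by rewrite size_map size_enum_ord.
have [t0 _] := card_gt0P T0.
have Smem : S (max_growth k `^ k%:R^-1).
  have [w _ hw] := eq_bigmax (nseq_tuple k t0) xpredT
    (fun w : k.-tuple T => norm2 (word_mx w)) isT (fun w _ => norm2_ge0 (word_mx w)).
  exists (map_tuple f w) => [i|]; first by exists (tnth w i); rewrite ?tnth_map.
  by rewrite /= foldE /max_growth hw.
apply/eqP; rewrite eq_le ub_le_sup ?ge_sup //; by exists (max_growth k `^ k%:R^-1).
Qed.

Lemma is_cvg_max_growth : cvg ((fun k => max_growth k `^ k%:R^-1) @ \oo).
Proof.
by apply: cvg_root_submultiplicative; [exact: max_growth_ge0|exact: max_growthM].
Qed.

(** Convergence of the limit yields one length k whose products have rate below
    [r]; submultiplicativity then spreads this rate to all lengths. *)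
Lemma jsr_lt_growth (r : R) : jsr (range f) < r ->
  exists C q : R, [/\ 0 < C, 0 < q, q < r &
    forall w, norm2 (word_mx w) <= C * q ^+ size w].
Proof.
rewrite jsrE => jr; set l := lim _ in jr; pose q := (l + r) / 2.
have l0 : 0 <= l by apply: limr_ge; [exact: is_cvg_max_growth|near=> k; exact: powR_ge0].
have q0 : 0 < q by rewrite /q; lra.
have qr : q < r by rewrite /q; lra.
have lq : l < q by rewrite /q; lra.
have [k [k0 hk]] : exists k, (0 < k)%N /\ max_growth k `^ k%:R^-1 < q.
  near \oo => k; exists k; split; first by near: k; exact: nbhs_infty_gt.
  by near: k; apply: cvgr_lt lq; exact: is_cvg_max_growth.
have gk : max_growth k <= q ^+ k.
  have -> : max_growth k = (max_growth k `^ k%:R^-1) ^+ k.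
    rewrite -powR_mulrn ?powR_ge0 // -powRrM mulVf ?pnatr_eq0 -?lt0n //.
    by rewrite powRr1 ?max_growth_ge0.
  by rewrite lerXn2r ?nnegrE ?powR_ge0 ?ltW.
have [C C0 hC] := submultiplicative_growth max_growth_ge0 max_growthM k0 q0 gk.
exists C, q; split => // w; exact: le_trans (le_max_growth w) (hC _).
Unshelve. all: by end_near. Qed.

Lemma jsr_le_growth (C q : R) : 0 < C -> 0 <= q ->
  (forall w, norm2 (word_mx w) <= C * q ^+ size w) -> jsr (range f) <= q.
Proof.
move=> C0 q0 hw; rewrite jsrE -(cvg_lim _ (cvg_root_geometric C0 q0)) //.
apply: ler_lim; [exact: is_cvg_max_growth|by apply/cvg_ex; exists q; exact: cvg_root_geometric|].
near=> k; have Cq0 : 0 <= C * q ^+ k by rewrite mulr_ge0 ?exprn_ge0 ?(ltW C0).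
rewrite ge0_ler_powR ?invr_ge0 ?nnegrE ?max_growth_ge0 //.
by apply: max_growth_le => // w <-.
Unshelve. all: by end_near. Qed.

Lemma jsr_ge_growth (c q : R) : 0 < c -> 0 <= q ->
  (forall w, c * q ^+ size w <= norm2 (word_mx w)) -> q <= jsr (range f).
Proof.
move=> c0 q0 hw; rewrite jsrE -(cvg_lim _ (cvg_root_geometric c0 q0)) //.
have [t0 _] := card_gt0P T0.
apply: ler_lim; [by apply/cvg_ex; exists q; exact: cvg_root_geometric|exact: is_cvg_max_growth|].
near=> k; have cq0 : 0 <= c * q ^+ k by rewrite mulr_ge0 ?exprn_ge0 ?(ltW c0).
rewrite ge0_ler_powR ?invr_ge0 ?nnegrE ?max_growth_ge0 //.
by have := le_trans (hw (nseq k t0)) (le_max_growth _); rewrite size_nseq.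
Unshelve. all: by end_near. Qed.
End FiniteFamily.

(** * Norms adapted to a finite family *)

Definition equivalent_norm (R : realType) (m : nat) (C : R)
    (N : 'cV[R]_m -> R) : Prop :=
  [/\ forall x, norm2 x <= N x, forall x, N x <= C * norm2 x,
      forall x y, N (x + y) <= N x + N y &
      forall a x, N (a *: x) <= `|a| * N x].

Lemma equivalent_norm_sum (R : realType) (m : nat) (C : R) (N : 'cV[R]_m -> R)
    (I : finType) (c : I -> R) (F : I -> 'cV[R]_m) (b : R) :
  equivalent_norm C N -> (forall i, 0 <= c i) -> \sum_i c i = 1 ->
  (forall i, N (F i) <= b) -> N (\sum_i c i *: F i) <= b.
Proof.
move=> [_ _ ND NZ] c0 c1 Fb.
have N0 : N 0 <= 0.
  rewrite -(scale0r (0 : 'cV[R]_m)); apply: (le_trans (NZ _ _)).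
  by rewrite normr0 mul0r.
apply: (@le_trans _ _ (\sum_i c i * b)); last by rewrite -mulr_suml c1 mul1r.
elim/big_ind2: _ => [|x1 x2 y1 y2 h1 h2|i _] //.
  exact: (le_trans (ND _ _) (lerD h1 h2)).
by apply: (le_trans (NZ _ _)); rewrite ger0_norm // ler_wpM2l.
Qed.

(** The supremum of |A_w x| / q ^ |w| over all words w: prefixing w by one more
    letter costs exactly one factor q. *)
Lemma contracting_norm (R : realType) (m : nat) (T : finType)
    (f : T -> 'M[R]_m) (C q : R) :
  0 < q -> (forall w, norm2 (word_mx f w) <= C * q ^+ size w) ->
  exists2 N : 'cV[R]_m -> R,
    equivalent_norm C N & forall t x, N (f t *m x) <= q * N x.
Proof.
move=> q0 hw.
pose h (x : 'cV[R]_m) (w : seq T) := norm2 (word_mx f w *m x) / q ^+ size w.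
pose N x := sup (range (h x)).
have hC x w : h x w <= C * norm2 x.
  rewrite ler_pdivrMr ?exprn_gt0 // mulrAC.
  apply: (le_trans (norm2M _ _)); by rewrite ler_wpM2r ?norm2_ge0.
have hN x w : h x w <= N x.
  by apply: ub_le_sup; [exists (C * norm2 x) => _ [v _ <-]|exists w].
have Nle x c : (forall w, h x w <= c) -> N x <= c.
  by move=> hc; apply: ge_sup; [exists (h x [::]); exists [::]|move=> _ [w _ <-]].
exists N; first split.
- by move=> x; apply: le_trans (hN x [::]); rewrite /h /= mul1mx expr0 divr1.
- by move=> x; exact: Nle.
- move=> x y; apply: Nle => w; apply: le_trans (lerD (hN x w) (hN y w)).
  by rewrite -mulrDl ler_wpM2r ?invr_ge0 ?exprn_ge0 ?(ltW q0) // mulmxDr norm2D.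
- move=> a x; apply: Nle => w; apply: le_trans (ler_wpM2l (normr_ge0 a) (hN x w)).
  by rewrite /h -scalemxAr norm2Z mulrA.
- move=> t x; apply: Nle => w; apply: le_trans (ler_wpM2l (ltW q0) (hN x (t :: w))).
  rewrite /h word_mx_cons /= exprS invfM mulmxA.
  by rewrite [leRHS]mulrCA mulVKf ?gt_eqF.
Qed.

Lemma contraction_growth (R : realType) (n : nat) (T : finType)
    (f : T -> 'M[R]_n) (C1 C2 b : R) (N : 'cV[R]_n -> R) :
  0 <= b -> 0 <= C1 -> (forall z, norm2 z <= C1 * N z) ->
  (forall z, N z <= C2 * norm2 z) -> (forall t z, N (f t *m z) <= b * N z) ->
  forall w, norm2 (word_mx f w) <= (n * n)%:R * (C1 * C2) * b ^+ size w.
Proof.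
move=> b0 C10 hC1 hC2 hf w.
have hN z : N (word_mx f w *m z) <= b ^+ size w * N z.
  elim/last_ind: w => [|w t IH]; first by rewrite mul1mx expr0 mul1r.
  rewrite word_mx_rcons -mulmxA size_rcons exprS -mulrA.
  by apply: (le_trans (hf _ _)); rewrite ler_wpM2l.
rewrite -!mulrA; apply: norm2_le_operator => z; apply: (le_trans (hC1 _)).
rewrite -!mulrA ler_wpM2l // (le_trans (hN z)) // mulrCA ler_wpM2l ?exprn_ge0 //.
Qed.

(** * Heavy-ball perturbation of a family with a common eigenvector *)

(** The numbers [l1] and [l2] are the roots of X^2 - (r + eta) X + eta, written
    through Vieta's relations.  The bound on eta makes the discriminant positive;
    the distinctness of the roots is needed to use them as coordinates. *)
Lemma heavy_ball_roots (R : realType) (r eta : R) :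
  0 < r -> r < 1 -> 0 < eta -> eta < r ^+ 2 / 4 ->
  exists l1 l2 : R,
    [/\ 0 < l2, l2 < l1, l1 < r, l1 + l2 = r + eta & l1 * l2 = eta].
Proof.
move=> r0 r1 e0 er; pose D := (r + eta) ^+ 2 - 4 * eta.
have D0 : 0 < D by rewrite /D; nra.
have er' : eta < r by nra.
pose s := Num.sqrt D.
have s0 : 0 < s by rewrite sqrtr_gt0.
have s2 : s ^+ 2 = D by rewrite sqr_sqrtr ?ltW.
(* (r - eta)^2 - D = 4 eta (1 - r): this is where r < 1 enters. *)
have sr : s < r - eta.
  rewrite -(@ltr_pXn2r _ 2) ?nnegrE ?(ltW s0) ?subr_ge0 ?(ltW er') // s2 /D; nra.
exists ((r + eta + s) / 2), ((r + eta - s) / 2); split; try lra.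
have -> : (r + eta + s) / 2 * ((r + eta - s) / 2) = ((r + eta) ^+ 2 - s ^+ 2) / 4 by field.
by rewrite s2 /D; field.
Qed.

(** Companion form: the state stacks the current iterate on the previous one. *)
Definition heavy_ball_mx (R : realType) (n : nat) (eta : R) (A : 'M[R]_n) :
  'M[R]_(n + n) := block_mx (A + eta%:M) (- eta%:M) 1%:M 0.

Lemma heavy_ball_mxE (R : realType) (n : nat) (eta : R) (A : 'M[R]_n)
    (x y : 'cV[R]_n) :
  heavy_ball_mx eta A *m col_mx x y =
  col_mx (A *m x + eta *: x - eta *: y) x.
Proof.
rewrite /heavy_ball_mx mul_block_col mulmxDl mulNmx !mul_scalar_mx.
by rewrite scale1r mul0mx addr0.
Qed.

(** A vector is split as x = U (W x) + (l x) v, where v is a common eigenvector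
    of the family [G] for the dominant eigenvalue r, and the parts W A U
    transverse to v contract by q < r in the norm [N]. *)
Section HeavyBall.
Variables (R : realType) (n p : nat) (r q C K : R).
Variables (v : 'cV[R]_n) (l : 'rV[R]_n) (U : 'M[R]_(n, p)) (W : 'M[R]_(p, n)).
Variables (G : set 'M[R]_n) (N : 'cV[R]_p -> R).
Hypotheses (q_gt0 : 0 < q) (qr : q < r) (r_lt1 : r < 1).
Hypotheses (UW : U *m W + v *m l = 1%:M) (Wv : W *m v = 0) (lv : l *m v = 1%:M).
Hypothesis C_gt0 : 0 < C.
Hypothesis normN : equivalent_norm C N.
Hypothesis G_eigen : forall A, G A -> A *m v = r *: v.
Hypothesis G_bound : forall A, G A -> norm2 A <= K.
Hypothesis G_contract : forall A y, G A -> N (W *m A *m U *m y) <= q * N y.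

Let coef (x : 'cV[R]_n) : R := (l *m x) 0 0.

Lemma coef_decomp (x : 'cV[R]_n) : x = U *m (W *m x) + coef x *: v.
Proof.
rewrite -[x in LHS]mul1mx -UW mulmxDl -!mulmxA [l *m x]mx11_scalar mul_mx_scalar.
by rewrite -/(coef x).
Qed.

Lemma coefD x y : coef (x + y) = coef x + coef y.
Proof. by rewrite /coef mulmxDr mxE. Qed.

Lemma coefZ a x : coef (a *: x) = a * coef x.
Proof. by rewrite /coef -scalemxAr mxE. Qed.

(** A maps v to a multiple of itself, hence only the transverse part leaks into
    the coefficient along v; no coefficient leaks back. *)
Lemma coef_step A (x : 'cV[R]_n) : G A ->
  coef (A *m x) = r * coef x + coef (A *m U *m (W *m x)).
Proof.
move=> GA; rewrite {1}(coef_decomp x) mulmxDr -scalemxAr (G_eigen GA).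
rewrite coefD !coefZ addrC mulmxA; congr (_ + _).
have -> : coef v = 1 by rewrite /coef lv mxE eqxx.
by rewrite mulr1 mulrC.
Qed.

Lemma transverse_step A (x : 'cV[R]_n) : G A -> W *m (A *m x) = W *m A *m U *m (W *m x).
Proof.
move=> GA; rewrite {1}(coef_decomp x) mulmxDr -scalemxAr (G_eigen GA) mulmxDr.
by rewrite -!scalemxAr Wv !scaler0 addr0 !mulmxA.
Qed.

(** With c, c' the coefficients along v of the current and previous iterates,
    c - l2 c' and c - l1 c' are eigen-coordinates of the unperturbed two-term
    recursion, with eigenvalues l1 and l2.  The norm is the maximum of their
    absolute values and of k N(W x) and k q' N(W x'): the factor q' makes the shift
    of the current iterate into the previous one contract by q', and the weight k
    makes the leak of the transverse part into c at most e = (r - l1) / 2 times the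
    norm. *)
Lemma heavy_ball_norm : exists2 eta0 : R, 0 < eta0 &
  forall eta, 0 < eta -> eta < eta0 ->
  exists (b C1 C2 : R) (NN : 'cV[R]_(n + n) -> R),
    [/\ 0 < b < r, 0 < C1 /\ 0 < C2,
        forall z, norm2 z <= C1 * NN z,
        forall z, NN z <= C2 * norm2 z &
        forall A z, G A -> NN (heavy_ball_mx eta A *m z) <= b * NN z].
Proof.
have [N1 N2 ND NZ] := normN.
have q0 := q_gt0; have q_r := qr; have r1 := r_lt1.
have r0 : 0 < r := lt_trans q_gt0 qr.
pose q' := (q + r) / 2.
have q'0 : 0 < q' by rewrite /q'; lra.
have qq' : q < q' by rewrite /q'; lra.
have q'r : q' < r by rewrite /q'; lra.
(* The first bound makes the roots real and distinct, the second is
   q + eta + eta / q' <= q'. *)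
exists (Num.min (r ^+ 2 / 4) ((q' - q) * q' / (1 + q'))).
  by rewrite lt_min !divr_gt0 ?exprn_gt0 ?mulr_gt0 ?subr_gt0 ?addr_gt0.
move=> eta e0; rewrite lt_min => /andP[er etaq].
have [l1 [l2 [l20 l21 l1r lD lM]]] := heavy_ball_roots r0 r_lt1 e0 er.
have eq' : q + eta + eta / q' <= q'.
  rewrite ltr_pdivlMr in etaq; last by rewrite addr_gt0.
  rewrite -(ler_pM2r q'0) mulrDl divfK ?gt_eqF //; nra.
(* L bounds the leak of the transverse part into the coefficient along v. *)
pose L := norm2 l * (K * norm2 U).
pose e := (r - l1) / 2.
have e_gt0 : 0 < e by rewrite /e; lra.
have er1 : l1 + e < r by rewrite /e; lra.
pose k := `|L| / e + 1.
have k0 : 0 < k by rewrite ltr_wpDl // divr_ge0 // ltW.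
have Lk : `|L| <= e * k by rewrite /k mulrDr mulr1 mulrC divfK ?gt_eqF // lerDl ltW.
have N0 y : 0 <= N y := le_trans (norm2_ge0 y) (N1 y).
pose NN (z : 'cV[R]_(n + n)) :=
  let x := usubmx z in let x' := dsubmx z in
  Num.max (Num.max (k * N (W *m x)) (k * q' * N (W *m x')))
          (Num.max `|coef x - l2 * coef x'| `|coef x - l1 * coef x'|).
have NNE x x' : NN (col_mx x x') =
  Num.max (Num.max (k * N (W *m x)) (k * q' * N (W *m x')))
          (Num.max `|coef x - l2 * coef x'| `|coef x - l1 * coef x'|).
  by rewrite /NN col_mxKu col_mxKd.
have NNge x x' : [/\ N (W *m x) <= NN (col_mx x x') / k,
    N (W *m x') <= NN (col_mx x x') / (k * q'),
    `|coef x - l2 * coef x'| <= NN (col_mx x x') &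
    `|coef x - l1 * coef x'| <= NN (col_mx x x')].
  rewrite !ler_pdivlMr ?(mulr_gt0 k0 q'0) // !(mulrC (N _)) NNE.
  by split; rewrite !le_max lexx ?orbT.
have NN0 z : 0 <= NN z by rewrite /NN /= !le_max mulr_ge0 ?(ltW k0).
have coef_le x : `|coef x| <= norm2 l * norm2 x.
  exact: le_trans (norm2_entry _ _ _) (norm2M _ _).
exists (Num.max q' (l1 + e)).
exists (norm2 U / k + norm2 v * (1 + l2 * (2 / (l1 - l2))) +
  (norm2 U / (k * q') + norm2 v * (2 / (l1 - l2))) + 1).
exists (k * (C * norm2 W) + k * q' * (C * norm2 W) + norm2 l * (1 + l2)
  + norm2 l * (1 + l1) + 1), NN.
have l120 : 0 < l1 - l2 by lra.
split.
- by rewrite lt_max q'0 gt_max q'r.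
- have kq0 := mulr_gt0 k0 q'0; have l10 := lt_trans l20 l21.
  by split; rewrite ltr_wpDl //; do ?[exact: ltW|exact: norm2_ge0|
    apply: addr_ge0|apply: mulr_ge0|rewrite invr_ge0].
- move=> z; rewrite -(vsubmxK z); set x := usubmx z; set x' := dsubmx z.
  have [h1 h2 h3 h4] := NNge x x'; set B := NN _ in h1 h2 h3 h4 *.
  have B0 : 0 <= B by exact: NN0.
  have split_le t : norm2 t <= norm2 U * N (W *m t) + norm2 v * `|coef t|.
    rewrite {1}(coef_decomp t); apply: (le_trans (norm2D _ _)).
    rewrite norm2Z [leRHS]addrC [leLHS]addrC (mulrC (norm2 v)) lerD2l.
    apply: (le_trans (norm2M _ _)).
    by rewrite ler_wpM2l ?norm2_ge0.
  have c'_le : `|coef x'| <= 2 / (l1 - l2) * B.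
    rewrite mulrAC ler_pdivlMr // -{1}(gtr0_norm l120) -normrM.
    have -> : coef x' * (l1 - l2) = (coef x - l2 * coef x') - (coef x - l1 * coef x') by ring.
    by apply: (le_trans (ler_normB _ _)); lra.
  have c_le : `|coef x| <= (1 + l2 * (2 / (l1 - l2))) * B.
    have -> : coef x = (coef x - l2 * coef x') + l2 * coef x' by ring.
    apply: (le_trans (ler_normD _ _)); rewrite mulrDl mul1r lerD // normrM gtr0_norm //.
    by rewrite -mulrA ler_wpM2l ?(ltW l20).
  apply: (le_trans (norm2_col_mx_le _ _)).
  apply: (le_trans (lerD (split_le x) (split_le x'))).
  move: c_le c'_le; set a := 1 + _; set a' := 2 / _ => c_le c'_le.
  have -> : (norm2 U / k + norm2 v * a + (norm2 U / (k * q') + norm2 v * a') + 1) * B =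
     (norm2 U * (B / k) + norm2 v * (a * B)) +
     (norm2 U * (B / (k * q')) + norm2 v * (a' * B)) + B by ring.
  by rewrite ler_wpDr // lerD // lerD // ler_wpM2l ?norm2_ge0.
- move=> z; rewrite -(vsubmxK z); set x := usubmx z; set x' := dsubmx z.
  have [hx hx'] := norm2_le_col_mx x x'; set Z := norm2 (col_mx x x') in hx hx' *.
  have Z0 : 0 <= Z by exact: norm2_ge0.
  have NW t : norm2 t <= Z -> N (W *m t) <= C * norm2 W * Z.
    move=> tZ; apply: (le_trans (N2 _)); rewrite -mulrA ler_wpM2l ?(ltW C_gt0) //.
    by apply: (le_trans (norm2M _ _)); rewrite ler_wpM2l ?norm2_ge0.
  have cZ t : norm2 t <= Z -> `|coef t| <= norm2 l * Z.
    by move=> tZ; apply: (le_trans (coef_le _)); rewrite ler_wpM2l ?norm2_ge0.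
  have wZ (s : R) : 0 < s -> `|coef x - s * coef x'| <= norm2 l * (1 + s) * Z.
    move=> s0; apply: (le_trans (ler_normB _ _)); rewrite normrM (gtr0_norm s0).
    have -> : norm2 l * (1 + s) * Z = norm2 l * Z + s * (norm2 l * Z) by ring.
    by apply: lerD; [exact: cZ|rewrite ler_wpM2l ?cZ ?(ltW s0)].
  have t1 : k * N (W *m x) <= k * (C * norm2 W) * Z.
    by rewrite -mulrA ler_wpM2l ?NW ?(ltW k0).
  have t2 : k * q' * N (W *m x') <= k * q' * (C * norm2 W) * Z.
    by rewrite -[leRHS]mulrA ler_wpM2l ?NW ?(ltW (mulr_gt0 k0 q'0)).
  have t3 := wZ l2 l20; have t4 := wZ l1 (lt_trans l20 l21).
  have t10 : 0 <= k * N (W *m x) by rewrite mulr_ge0 // ltW.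
  have t20 : 0 <= k * q' * N (W *m x') by rewrite mulr_ge0 ?(ltW (mulr_gt0 k0 q'0)).
  have t30 := normr_ge0 (coef x - l2 * coef x').
  have t40 := normr_ge0 (coef x - l1 * coef x').
  rewrite NNE !ge_max.
  by apply/andP; split; apply/andP; split; lra.
- move=> A z GA; rewrite -(vsubmxK z); set x := usubmx z; set x' := dsubmx z.
  have [h1 h2 h3 h4] := NNge x x'; set B := NN _ in h1 h2 h3 h4 *.
  have B0 : 0 <= B by exact: NN0.
  rewrite heavy_ball_mxE NNE.
  set x1 := A *m x + _ - _.
  have kN y : N y <= B / k -> k * N y <= B by rewrite ler_pdivlMr // mulrC.
  have d_le : `|coef (A *m U *m (W *m x))| <= e * B.
    apply: (le_trans (coef_le _)).
    apply: (@le_trans _ _ (L * N (W *m x))).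
      rewrite /L -!mulrA ler_wpM2l ?norm2_ge0 // -mulmxA.
      apply: (le_trans (norm2M _ _)); rewrite ler_pM ?norm2_ge0 ?G_bound //.
      by apply: (le_trans (norm2M _ _)); rewrite ler_wpM2l ?norm2_ge0.
    apply: (@le_trans _ _ (e * k * N (W *m x))).
      by rewrite ler_wpM2r // (le_trans (ler_norm _)).
    by rewrite -mulrA ler_wpM2l ?kN // ltW.
  have c1 : coef x1 = r * coef x + coef (A *m U *m (W *m x)) + eta * coef x - eta * coef x'.
    by rewrite /x1 -scaleNr !coefD !coefZ coef_step // mulNr.
  set b := Num.max q' (l1 + e).
  have bq : q' <= b by rewrite le_max lexx.
  have bl : l1 + e <= b by rewrite le_max lexx orbT.
  (* One of the two eigen-coordinates, with s its eigenvalue and s' the other. *)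
  have lin (s s' : R) : 0 < s -> s <= l1 -> s + s' = r + eta -> s * s' = eta ->
      `|coef x - s' * coef x'| <= B -> `|coef x1 - s' * coef x| <= b * B.
    move=> s0 sl sD sM hB.
    have -> : coef x1 - s' * coef x =
        s * (coef x - s' * coef x') + coef (A *m U *m (W *m x)).
      rewrite c1 mulrBr mulrA sM; have -> : s = r + eta - s' by rewrite -sD addrK.
      by ring.
    apply: (le_trans (ler_normD _ _)); rewrite normrM (gtr0_norm s0).
    apply: (@le_trans _ _ ((l1 + e) * B)); last by rewrite ler_wpM2r.
    by rewrite mulrDl lerD // ler_pM // ltW.
  rewrite !ge_max; apply/andP; split; apply/andP; split.
  + apply: (@le_trans _ _ (q' * B)); last by rewrite ler_wpM2r.
    have -> : W *m x1 = W *m A *m U *m (W *m x) + (eta *: (W *m x) + (- eta) *: (W *m x')).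
      by rewrite /x1 addrA -scaleNr !mulmxDr -!scalemxAr transverse_step.
    have hN : N (W *m A *m U *m (W *m x) + (eta *: (W *m x) + (- eta) *: (W *m x')))
        <= q * (B / k) + (eta * (B / k) + eta * (B / (k * q'))).
      apply: (le_trans (ND _ _)); apply: lerD.
        by apply: (le_trans (G_contract _ GA)); rewrite ler_wpM2l ?(ltW q_gt0).
      apply: (le_trans (ND _ _)); apply: lerD; apply: (le_trans (NZ _ _)).
        by rewrite gtr0_norm // ler_wpM2l ?(ltW e0).
      by rewrite normrN gtr0_norm // ler_wpM2l ?(ltW e0).
    apply: (le_trans (ler_wpM2l (ltW k0) hN)).
    have -> : k * (q * (B / k) + (eta * (B / k) + eta * (B / (k * q')))) =
        (q + eta + eta / q') * B by field; rewrite !gt_eqF.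
    by rewrite ler_wpM2r.
  + apply: (@le_trans _ _ (q' * B)); last by rewrite ler_wpM2r.
    by rewrite mulrAC mulrC ler_wpM2l ?kN ?(ltW q'0).
  + by apply: (lin l1) => //; exact: lt_trans l21.
  + by apply: (lin l2) => //; [exact: ltW|rewrite addrC|rewrite mulrC].
Qed.
End HeavyBall.

(** * Stochastic policies *)

Definition stochastic (R : realType) (nS nA : nat)
    (mu : 'I_nS.+1 -> 'I_nA.+1 -> R) : Prop :=
  (forall s a, 0 <= mu s a) /\ forall s, \sum_a mu s a = 1.

Lemma one_hot_stochastic (R : realType) (nS nA : nat)
    (pi : {ffun 'I_nS.+1 -> 'I_nA.+1}) : stochastic (one_hot R pi).
Proof.
split=> [s a|s]; rewrite /one_hot ?ler0n //.
rewrite (bigD1 (pi s)) //= eqxx big1 ?addr0 // => a /negPf ->.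
by [].
Qed.

(** The probability of the deterministic policy [pi] when the actions of
    different states are drawn independently from [mu]. *)
Definition policy_weight (R : realType) (nS nA : nat)
    (mu : 'I_nS.+1 -> 'I_nA.+1 -> R) (pi : {ffun 'I_nS.+1 -> 'I_nA.+1}) : R :=
  \prod_s mu s (pi s).

Lemma policy_weight_ge0 (R : realType) (nS nA : nat)
    (mu : 'I_nS.+1 -> 'I_nA.+1 -> R) pi :
  stochastic mu -> 0 <= policy_weight mu pi.
Proof. by move=> [mu0 _]; apply: prodr_ge0. Qed.

Lemma policy_weight_sum1 (R : realType) (nS nA : nat)
    (mu : 'I_nS.+1 -> 'I_nA.+1 -> R) :
  stochastic mu -> \sum_pi policy_weight mu pi = 1.
Proof. by move=> [_ mu1]; rewrite -bigA_distr_bigA big1. Qed.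

(** Restricting the product of the row sums to [pi s = a] replaces the factor of
    the state s by [mu s a] and leaves the other factors equal to 1. *)
Lemma policy_weight_marginal (R : realType) (nS nA : nat)
    (mu : 'I_nS.+1 -> 'I_nA.+1 -> R) s a :
  stochastic mu -> \sum_pi policy_weight mu pi * one_hot R pi s a = mu s a.
Proof.
move=> [_ mu1]; pose F s' a' := mu s' a' * (if s' == s then (a == a')%:R else 1).
transitivity (\sum_(pi : {ffun 'I_nS.+1 -> 'I_nA.+1}) \prod_s' F s' (pi s')).
  apply: eq_bigr => pi _; rewrite big_split /=; congr (_ * _).
  by rewrite (bigD1 s) //= eqxx big1 ?mulr1 // => i /negPf ->.
rewrite -bigA_distr_bigA (bigD1 s) //= [X in _ * X]big1 => [|s' /negPf ss].
  rewrite mulr1 /F eqxx (bigD1 a) //= eqxx mulr1 big1 ?addr0 // => a'.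
  by rewrite eq_sym => /negPf ->; rewrite mulr0.
by rewrite -(mu1 s'); apply: eq_bigr => a' _; rewrite /F ss mulr1.
Qed.

Lemma policy_mx_entry (R : realType) (nS nA : nat)
    (mu : 'I_nS.+1 -> 'I_nA.+1 -> R) s a s' :
  policy_mx mu s (mxvec_index a s') = if s' == s then mu s a else 0.
Proof. by rewrite mxE -/(sa_val _ _ _) sa_vecK. Qed.

Lemma policy_mx_convex (R : realType) (nS nA : nat)
    (mu : 'I_nS.+1 -> 'I_nA.+1 -> R) :
  stochastic mu ->
  policy_mx mu = \sum_pi policy_weight mu pi *: policy_mx (one_hot R pi).
Proof.
move=> hmu; apply/matrixP => s j; case/mxvec_indexP: j => a s'.
rewrite summxE policy_mx_entry.
under eq_bigr => pi _ do rewrite mxE policy_mx_entry.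
case: eqP => _; first by rewrite policy_weight_marginal.
by rewrite big1 // => pi _; rewrite mulr0.
Qed.

(** The difference of maxima lies between the differences taken at an argmax of
    [g] and at an argmax of [f], so two actions carry the weights. *)
Lemma max_difference_convex (R : realType) (nA : nat) (f g : 'I_nA.+1 -> R) :
  exists p : 'I_nA.+1 -> R,
    [/\ forall a, 0 <= p a, \sum_a p a = 1 &
      \big[Num.max/f ord0]_a f a - \big[Num.max/g ord0]_a g a =
      \sum_a p a * (f a - g a)].
Proof.
have maxP (h : 'I_nA.+1 -> R) : exists a0, \big[Num.max/h ord0]_a h a = h a0 /\
    forall a, h a <= h a0.
  exists [arg max_(a > ord0 | true) h a]%O; case: Order.TotalTheory.arg_maxP => // a0 _ ha0.
  split; last by move=> a; exact: ha0.
  by apply/eqP; rewrite eq_le bigmax_le //= ?le_bigmax //; move=> *; exact: ha0.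
have [a1 [-> f1]] := maxP f; have [a2 [-> g2]] := maxP g.
set d := f a1 - g a2; pose u := f a1 - g a1; pose w := f a2 - g a2.
have du : d <= u by rewrite /d /u lerD2l lerN2.
have wd : w <= d by rewrite /d /w lerD2r.
pose t := (d - w) / (u - w).
have t0 : 0 <= t by rewrite divr_ge0 // subr_ge0 // (le_trans wd).
have t1 : t <= 1.
  (* If u = w then t is 0 by the convention on division, which is correct. *)
  have [uw|uw] := eqVneq u w; first by rewrite /t uw subrr invr0 mulr0 ler01.
  by rewrite ler_pdivrMr ?mul1r ?lerD2r // subr_gt0 lt_neqAle eq_sym uw (le_trans wd).
have dE : d = t * u + (1 - t) * w.
  have [uw|uw] := eqVneq u w.
    have -> : d = w by apply/eqP; rewrite eq_le wd -uw du.
    by rewrite uw -mulrDl addrC subrK mul1r.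
  have uw' : u - w != 0 by rewrite subr_eq0.
  by rewrite /t; field.
exists (fun a => t * (a == a1)%:R + (1 - t) * (a == a2)%:R).
have sum1 (h : 'I_nA.+1 -> R) a0 : \sum_a (a == a0)%:R * h a = h a0.
  rewrite (bigD1 a0) //= eqxx mul1r big1 ?addr0 // => a /negPf ->.
  by rewrite mul0r.
split.
- by move=> a; rewrite addr_ge0 // mulr_ge0 ?ler0n // subr_ge0.
- rewrite big_split -!mulr_sumr /=.
  have s1 a0 : \sum_(a < nA.+1) (a == a0)%:R = 1 :> R.
    by rewrite -[RHS](sum1 (fun _ => 1) a0); apply: eq_bigr => a _; rewrite mulr1.
  by rewrite !s1 !mulr1 addrC subrK.
- clearbody t; under eq_bigr => a _ do rewrite mulrDl -!mulrA.
  rewrite big_split -!mulr_sumr /= !(sum1 (fun a => f a - g a)); exact: dE.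
Qed.

Lemma greedy_value_difference (R : realType) (nS nA : nat)
    (Q Q' : 'cV[R]_(sa_dim nS nA)) :
  exists2 mu : 'I_nS.+1 -> 'I_nA.+1 -> R, stochastic mu &
    greedy_value Q - greedy_value Q' = policy_mx mu *m (Q - Q').
Proof.
have [mu hmu] := choice (fun s => max_difference_convex (sa_val Q s) (sa_val Q' s)).
exists mu; first by split=> [s a|s]; have [] := hmu s.
apply/matrixP => s j; rewrite (ord1 j) policy_mxE !mxE.
have [_ _ ->] := hmu s; apply: eq_bigr => a _.
by rewrite /sa_val !mxE.
Qed.

(** * Matrices with constant row sums *)

Lemma entry_le_row_sum (R : realType) (n : nat) (A : 'M[R]_n) (c : R) :
  (forall i j, 0 <= A i j) -> A *m (const_mx 1 : 'cV_n) = c *: const_mx 1 ->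
  forall i j, `|A i j| <= c.
Proof.
move=> A0 A1 i j; rewrite ger0_norm //.
have := congr1 (fun B : 'cV_n => B i 0) A1; rewrite !mxE mulr1 => <-.
rewrite (bigD1 j) //= mxE mulr1 lerDl sumr_ge0 // => k _.
by rewrite mxE mulr1.
Qed.

Lemma mulmx_ge0 (R : realType) (m n p : nat) (A : 'M[R]_(m, n)) (B : 'M[R]_(n, p)) :
  (forall i j, 0 <= A i j) -> (forall i j, 0 <= B i j) ->
  forall i j, 0 <= (A *m B) i j.
Proof. by move=> A0 B0 i j; rewrite mxE sumr_ge0 // => k _; rewrite mulr_ge0. Qed.

(** Upper bound: the entries of a nonnegative product are at most its row sum
    r ^ k.  Lower bound: apply the product to the all-ones vector. *)
Lemma jsr_constant_row_sum (R : realType) (n : nat) (T : finType)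
    (f : T -> 'M[R]_n) (r : R) :
  (0 < n)%N -> (0 < #|T|)%N -> 0 <= r ->
  (forall t i j, 0 <= f t i j) ->
  (forall t, f t *m (const_mx 1 : 'cV_n) = r *: const_mx 1) ->
  jsr (range f) = r.
Proof.
move=> n0 T0 r0 f0 f1.
have w0 w : forall i j, 0 <= word_mx f w i j.
  elim/last_ind: w => [|w t IH] i j; first by rewrite mxE ler0n.
  by rewrite word_mx_rcons mulmx_ge0.
have w1 w : word_mx f w *m (const_mx 1 : 'cV_n) = r ^+ size w *: const_mx 1.
  elim/last_ind: w => [|w t IH]; first by rewrite mul1mx expr0 scale1r.
  by rewrite word_mx_rcons -mulmxA IH -scalemxAr f1 scalerA size_rcons exprSr.
apply/eqP; rewrite eq_le; apply/andP; split.
  apply: (@jsr_le_growth _ _ _ f T0 (n * n)%:R) => // [|w].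
    by rewrite ltr0n muln_gt0 n0.
  by apply: norm2_le_entries; apply: entry_le_row_sum.
apply: (@jsr_ge_growth _ _ _ f T0 1) => // w; rewrite mul1r.
have one0 : 0 < norm2 (const_mx 1 : 'cV[R]_n).
  apply: (lt_le_trans (@ltr01 R)).
  by have := norm2_entry (const_mx 1 : 'cV[R]_n) (Ordinal n0) 0; rewrite mxE normr1.
rewrite -(ler_pM2r one0) -[X in X * _](ger0_norm (exprn_ge0 _ r0)) -norm2Z -w1.
exact: norm2M.
Qed.

(** * Value iteration *)

Section ValueIteration.
Variables (R : realType) (nS nA : nat) (M : mdp R nS nA) (alpha : R).
Hypotheses (alpha_gt0 : 0 < alpha) (alpha_le1 : alpha <= 1).
Local Notation n := (sa_dim nS nA).
Local Notation gamma := (discount M).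

Definition policy_qvi_mx (mu : 'I_nS.+1 -> 'I_nA.+1 -> R) : 'M[R]_n :=
  (1 - alpha)%:M + (alpha * gamma) *: (trans_mx M *m policy_mx mu).

Definition qvi_rate : R := 1 - alpha + alpha * gamma.

Lemma qvi_rate_gt0 : 0 < qvi_rate.
Proof. by rewrite ltr_wpDl ?subr_ge0 // mulr_gt0 // discount_gt0. Qed.

Lemma qvi_rate_lt1 : qvi_rate < 1.
Proof.
have g1 := discount_lt1 M; have a0 := alpha_gt0.
by rewrite /qvi_rate; nra.
Qed.

Lemma trans_mx_entry s a s' : trans_mx M (mxvec_index a s) s' = trans M s a s'.
Proof. by rewrite mxE -/(sa_val _ _ _) sa_vecK. Qed.

Lemma policy_qvi_mx_ge0 mu : stochastic mu -> forall i j, 0 <= policy_qvi_mx mu i j.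
Proof.
move=> [mu0 _] i j; rewrite !mxE addr_ge0 ?mulrn_wge0 ?subr_ge0 //.
rewrite mulr_ge0 ?mulr_ge0 ?(ltW alpha_gt0) ?(ltW (discount_gt0 M)) //.
apply: sumr_ge0 => s' _; rewrite mulr_ge0 //.
  by case/mxvec_indexP: i => a s; rewrite trans_mx_entry trans_ge0.
by case/mxvec_indexP: j => a s; rewrite policy_mx_entry; case: ifP.
Qed.

Lemma policy_qvi_mx_ones mu : stochastic mu ->
  policy_qvi_mx mu *m (const_mx 1 : 'cV_n) = qvi_rate *: const_mx 1.
Proof.
move=> [_ mu1]; rewrite mulmxDl mul_scalar_mx -scalemxAl -mulmxA [RHS]scalerDl.
congr (_ + _ *: _).
have -> : policy_mx mu *m (const_mx 1 : 'cV_n) = const_mx 1.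
  apply/matrixP => s j; rewrite (ord1 j) policy_mxE mxE -[RHS](mu1 s).
  by apply: eq_bigr => a _; rewrite /sa_val mxE mulr1.
apply/matrixP => i j; rewrite [LHS]mxE mxE.
case/mxvec_indexP: i => a s; rewrite -[RHS](trans_sum1 M s a).
by apply: eq_bigr => s' _; rewrite trans_mx_entry mxE mulr1.
Qed.

Lemma policy_qvi_mx_convex mu : stochastic mu ->
  policy_qvi_mx mu = \sum_pi policy_weight mu pi *: qvi_mx M alpha pi.
Proof.
move=> hmu; under eq_bigr => pi _ do rewrite /qvi_mx scalerDr.
rewrite big_split /= -scaler_suml policy_weight_sum1 // scale1r.
congr (_ + _); rewrite (policy_mx_convex hmu) mulmx_sumr scaler_sumr.
by apply: eq_bigr => pi _; rewrite -scalemxAr !scalerA mulrC.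
Qed.

Lemma card_policies : (0 < #|{ffun 'I_nS.+1 -> 'I_nA.+1}|)%N.
Proof. by apply/card_gt0P; exists [ffun=> ord0]. Qed.

Lemma jsr_qvi : jsr (qvi_family M alpha) = qvi_rate.
Proof.
apply: jsr_constant_row_sum => //; first exact: card_policies.
- exact: ltW qvi_rate_gt0.
- by move=> pi; apply: policy_qvi_mx_ge0; exact: one_hot_stochastic.
- by move=> pi; apply: policy_qvi_mx_ones; exact: one_hot_stochastic.
Qed.

Lemma hb_mxE eta pi : hb_mx M alpha eta pi = heavy_ball_mx eta (qvi_mx M alpha pi).
Proof.
by rewrite /hb_mx /heavy_ball_mx /qvi_mx raddfD /= addrAC.
Qed.

(** The policy depends on the current iterate, through the greedy actions of
    [z.1] and of the fixed point. *)
Lemma hb_step_error eta (Qstar : 'cV[R]_n) (z : 'cV[R]_n * 'cV[R]_n) :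
  bellman M Qstar = Qstar ->
  exists2 mu, stochastic mu &
    col_mx ((hb_step M alpha eta z).1 - Qstar) ((hb_step M alpha eta z).2 - Qstar) =
    heavy_ball_mx eta (policy_qvi_mx mu) *m col_mx (z.1 - Qstar) (z.2 - Qstar).
Proof.
move=> fixQ; have [mu hmu gv] := greedy_value_difference z.1 Qstar.
exists mu => //; rewrite heavy_ball_mxE /hb_step /=; congr col_mx.
have -> : bellman M z.1 = Qstar + gamma *: (trans_mx M *m (policy_mx mu *m (z.1 - Qstar))).
  rewrite -gv -{1}fixQ /bellman mulmxBr scalerBr -addrA; congr (_ + _).
  by rewrite addrC subrK.
rewrite mulmxDl mul_scalar_mx -scalemxAl -mulmxA; set X := trans_mx M *m _.
apply/matrixP => i j; rewrite !mxE; ring.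
Qed.
End ValueIteration.

(** The resolution of the identity of the orthogonal splitting into span(1) and
    its complement. *)
Lemma ones_complement_decomp (R : realType) (nS nA : nat)
    (U : 'M[R]_(sa_dim nS nA, (sa_dim nS nA).-1)) :
  ones_complement_basis U ->
  U^T *m (const_mx 1 : 'cV_(sa_dim nS nA)) = 0 /\
  U *m U^T + const_mx 1 *m ((sa_dim nS nA)%:R^-1 *: const_mx 1 : 'rV_(sa_dim nS nA)) = 1%:M.
Proof.
set n := sa_dim nS nA; move=> [UU spanU].
have U1 : U^T *m (const_mx 1 : 'cV_n) = 0.
  apply: trmx_inj; rewrite trmx_mul trmxK trmx_const trmx0.
  apply/matrixP => i j; rewrite (ord1 i).
  have /spanU h : exists y : 'cV_n.-1, U *m delta_mx j 0 = U *m y by eexists.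
  have := congr1 (fun B : 'cV[R]_1 => B 0 0) h.
  by rewrite mulmxA -colE !mxE.
split=> //; have n0 : n%:R != 0 :> R by rewrite pnatr_eq0.
have dec (x : 'cV[R]_n) :
    (U *m U^T + const_mx 1 *m (n%:R^-1 *: const_mx 1 : 'rV_n)) *m x = x.
  set c := n%:R^-1 * ((const_mx 1 : 'rV_n) *m x) 0 0.
  have cE : const_mx 1 *m (n%:R^-1 *: const_mx 1 : 'rV_n) *m x = c *: (const_mx 1 : 'cV_n).
    rewrite -mulmxA -scalemxAl [_ *m x in LHS]mx11_scalar scale_scalar_mx.
    by rewrite mul_mx_scalar.
  have one_one : (const_mx 1 : 'rV[R]_n) *m (const_mx 1 : 'cV_n) = n%:R%:M.
    apply/matrixP => i j; rewrite !mxE !ord1 eqxx mulr1n.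
    under eq_bigr => k _ do rewrite !mxE mulr1.
    by rewrite sumr_const card_ord.
  have [y hy] : exists y : 'cV_n.-1, x - c *: const_mx 1 = U *m y.
    apply/spanU; rewrite mulmxBr -scalemxAr one_one.
    rewrite [_ *m x]mx11_scalar scale_scalar_mx /c.
    by rewrite mulrAC mulVf // mul1r subrr.
  have xE : x = U *m y + c *: const_mx 1 by rewrite -hy subrK.
  rewrite mulmxDl cE {1}xE mulmxDr -scalemxAr -!mulmxA U1 mulmx0 scaler0 addr0.
  by rewrite (mulmxA U^T) UU mul1mx -xE.
apply/matrixP => i j.
have := congr1 (fun B : 'cV_n => B i 0) (dec (delta_mx j 0)).
by rewrite -colE mxE => ->; rewrite !mxE eqxx andbT.
Qed.

(** * Heavy-ball Q-value iteration *)

Unset Implicit Arguments.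

Theorem theorem6p1 (R : realType) (nS nA : nat) (M : mdp R nS nA) (alpha : R)
    (U : 'M[R]_(sa_dim nS nA, (sa_dim nS nA).-1))
    (alpha_gt0 : 0 < alpha) (alpha_le1 : alpha <= 1)
    (U_basis : ones_complement_basis U)
    (gap : jsr (qvi_proj_family M U alpha) < jsr (qvi_family M alpha)) :
  exists eta0 : R, 0 < eta0 /\
    forall eta : R,
      0 < eta -> eta < Num.min (jsr (qvi_family M alpha) ^+ 2) eta0 ->
      jsr (hb_family M alpha eta) < jsr (qvi_family M alpha) /\
      forall Qstar : 'cV[R]_(sa_dim nS nA), bellman M Qstar = Qstar ->
        exists C beta : R,
          [/\ 1 <= C, 0 < beta, beta < 1 &
            forall (Q0 Qm1 : 'cV[R]_(sa_dim nS nA)) (k : nat),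
              norm2 (col_mx ((hb_iter M alpha eta Q0 Qm1 k).1 - Qstar)
                            ((hb_iter M alpha eta Q0 Qm1 k).2 - Qstar))
              <= C * beta ^+ k * norm2 (col_mx (Q0 - Qstar) (Qm1 - Qstar))].
Proof.
have T0 := card_policies nS nA.
have jE := jsr_qvi M alpha_gt0 alpha_le1.
rewrite !jE in gap *; set r := qvi_rate M alpha in gap *.
have [C [q [C0 q0 qr hw]]] := jsr_lt_growth T0 gap.
have [N normN contrN] := contracting_norm q0 hw.
have [U1 UUv] := ones_complement_decomp U_basis.
pose G : set 'M[R]_(sa_dim nS nA) :=
  [set A | exists2 mu, stochastic mu & A = policy_qvi_mx M alpha mu].
have one_one : ((sa_dim nS nA)%:R^-1 *: const_mx 1 : 'rV[R]_(sa_dim nS nA))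
    *m const_mx 1 = 1%:M.
  apply/matrixP => i j; rewrite -scalemxAl !mxE !ord1 eqxx mulr1n.
  under eq_bigr => k _ do rewrite !mxE mulr1.
  by rewrite sumr_const card_ord mulVf // pnatr_eq0.
have Geigen A : G A -> A *m const_mx 1 = r *: (const_mx 1 : 'cV_(sa_dim nS nA)).
  by move=> [mu hmu ->]; exact: policy_qvi_mx_ones.
have Gbound A : G A -> norm2 A <= (sa_dim nS nA * sa_dim nS nA)%:R * r.
  move=> GA; apply: norm2_le_entries; apply: entry_le_row_sum; last exact: Geigen.
  by have [mu hmu ->] := GA; exact: policy_qvi_mx_ge0.
have Gcontr A y : G A -> N (U^T *m A *m U *m y) <= q * N y.
  move=> [mu hmu ->]; rewrite policy_qvi_mx_convex //.
  rewrite mulmx_sumr !mulmx_suml.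
  under eq_bigr => pi _ do rewrite -scalemxAr -!scalemxAl.
  apply: (equivalent_norm_sum normN) => [pi||pi].
  - exact: policy_weight_ge0.
  - exact: policy_weight_sum1.
  - exact: contrN.
have [eta0 e00 hb] := heavy_ball_norm q0 qr (qvi_rate_lt1 M alpha_gt0)
  UUv U1 one_one C0 normN Geigen Gbound Gcontr.
exists eta0; split=> // eta e0; rewrite lt_min => /andP[_ ee0].
have [b [C1 [C2 [NN [/andP[b0 br] [C10 C20] hC1 hC2 hNN]]]]] := hb eta e0 ee0.
split=> [|Qstar fixQ].
  apply: le_lt_trans br.
  have n0 : (0 < sa_dim nS nA + sa_dim nS nA)%N by [].
  apply: (@jsr_le_growth _ _ _ (hb_mx M alpha eta) T0
    (((sa_dim nS nA + sa_dim nS nA) * (sa_dim nS nA + sa_dim nS nA))%:R * (C1 * C2))).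
  - by rewrite !mulr_gt0 // ltr0n muln_gt0 n0.
  - exact: ltW.
  - apply: (contraction_growth (ltW b0) (ltW C10) hC1 hC2) => pi z.
    rewrite hb_mxE; apply: hNN; exists (one_hot R pi) => //.
    exact: one_hot_stochastic.
exists (1 + C1 * C2), b; split.
- by rewrite lerDl mulr_ge0 // ltW.
- exact: b0.
- exact: lt_trans br (qvi_rate_lt1 M alpha_gt0).
move=> Q0 Qm1 k; set z0 := norm2 (col_mx (Q0 - _) _).
have hk : NN (col_mx ((hb_iter M alpha eta Q0 Qm1 k).1 - Qstar)
    ((hb_iter M alpha eta Q0 Qm1 k).2 - Qstar)) <= b ^+ k * (C2 * z0).
  elim: k => [|k IH]; first by rewrite expr0 mul1r; exact: hC2.
  rewrite /hb_iter iterS -/(hb_iter M alpha eta Q0 Qm1 k).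
  have [mu hmu ->] := hb_step_error alpha eta (hb_iter M alpha eta Q0 Qm1 k) fixQ.
  rewrite exprS -mulrA; apply: (le_trans (hNN _ _ _)); first by exists mu.
  by rewrite ler_wpM2l // ltW.
apply: (le_trans (hC1 _)).
apply: (le_trans (ler_wpM2l (ltW C10) hk)).
have -> : C1 * (b ^+ k * (C2 * z0)) = C1 * C2 * (b ^+ k * z0) by ring.
by rewrite -[leRHS]mulrA ler_wpM2r ?lerDr // mulr_ge0 ?exprn_ge0 ?norm2_ge0 ?(ltW b0) //.
Qed.
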